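(* Let $S^1$ be the unit circle in $\mathbb{R}^2$ and let $\mathfrak{T}=S^1\times S^1\times S^1$, where a triple $(p,q,r)\in\mathfrak{T}$ is identified with the (possibly degenerate) triangle spanned by $p,q,r$. Let $\nu$ be a probability measure on $S^1$ and let $\mu_s=\nu\times\nu\times\nu$ be the corresponding product measure on $\mathfrak{T}$. Let $\mathcal{F}\subset\mathfrak{T}$ be a measurable intersecting family of triangles. Then $\mu_s(\mathcal{F})\leq \frac14$.
   Context: Two triangles are intersecting if their interiors intersect, and a family of triangles is intersecting if every two of its members are intersecting. *)

(* Defs.v *)
From HB Require Import structures.
From mathcomp Require Import all_boot all_order all_algebra.
From mathcomp Require Import all_classical all_reals all_analysis.
Set Implicit Arguments.
Unset Strict Implicit.
Unset Printing Implicit Defensive.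
Import Order.TTheory GRing.Theory Num.Theory.
Import numFieldNormedType.Exports.
Local Open Scope classical_set_scope.
Local Open Scope ring_scope.

Definition unit_circle (R : realType) : set (R * R) :=
  [set x | x.1 ^+ 2 + x.2 ^+ 2 = 1].

Definition circle_point (R : realType) : Type := set_type (@unit_circle R).

Definition circle_val (R : realType) (p : circle_point R) : R * R := set_val p.

(* The library requires measurable types to be pointed. *)
Lemma east_in_circle (R : realType) : ((1, 0) : R * R) \in @unit_circle R.
Proof. by rewrite inE /unit_circle /= expr1n expr0n addr0. Qed.

HB.instance Definition _ (R : realType) := Choice.on (circle_point R).
HB.instance Definition _ (R : realType) :=
  isPointed.Build (circle_point R) (exist _ (1, 0) (east_in_circle R)).

(* S^1 with its Borel sigma-algebra, obtained as the trace on S^1 of the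
   Borel sigma-algebra of the plane; the latter is the product of the Borel
   sigma-algebras of the two axes. *)
Definition circle (R : realType) : measurableType _ :=
  g_sigma_algebra_preimageType
    (@circle_val R : circle_point R -> measurableTypeR R * measurableTypeR R).

(* A notation, so that the library's product sigma-algebra is inferred. *)
Notation triangle_space R := (circle R * circle R * circle R)%type.

Definition triangle (R : realType) (t : triangle_space R) : set (R * R) :=
  let: (p, q, r) := t in
  [set z | exists a b c : R,
     [/\ 0 <= a, 0 <= b, 0 <= c, a + b + c = 1 &
         z = a *: circle_val p + b *: circle_val q + c *: circle_val r]].

(* The interior is taken in the plane, hence is empty for a degenerate
   triangle. *)
Definition triangles_intersect (R : realType) (s t : triangle_space R) : Prop :=
  (triangle s)° `&` (triangle t)° !=set0.

(* The two members may coincide; for s = t the condition says that the triangle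
   is nondegenerate. Without this, the singleton {(p, p, p)} would be an
   intersecting family, of measure 1 when nu is the Dirac mass at p. *)
Definition intersecting_family (R : realType) (F : set (triangle_space R)) :
    Prop :=
  forall s t, F s -> F t -> triangles_intersect s t.

(* Main.v *)
Require Import Defs.
From HB Require Import structures.
From mathcomp Require Import all_boot all_order all_algebra.
From mathcomp Require Import all_classical all_reals all_analysis.
From mathcomp Require Import measurable_realfun ring lra zify.
Import Order.TTheory GRing.Theory Num.Theory.
Import numFieldNormedType.Exports.
Local Open Scope classical_set_scope.
Local Open Scope ring_scope.

Set Implicit Arguments.
Unset Strict Implicit.
Unset Printing Implicit Defensive.

(* The quantile function of the angle splits nu into N = 2m+1 pieces of mass 1/N,
   cyclically ordered on the circle (atoms may be shared between pieces).  Given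
   pieces p, q, r in cyclic order and one further piece in each of the three
   arcs, the triangle p q r and the three "ears" cut off by its sides have
   disjoint interiors, so at most one of the four belongs to an intersecting
   family.  Take all p, q, r whose gaps are at most m, and average over the ears.
   A pair of pieces at distance a <= m is a side of exactly a of these
   triangles, and each ear over it gets weight 1/a in the average, so every
   triangle of pieces, containing the centre or not, is covered with total weight
   1.  There are N m(m+1)/2 choices of p, q, r up to orientation, so the family
   has measure at most N m(m+1) / N^3 up to O(1/N) for repeated pieces, which
   tends to 1/4. *)

(** * Orientation of points on the circle and separation by a chord *)

(** Twice the signed area of the triangle [p q z]; in [z] it is affine and vanishes on the line
    through [p] and [q]. *)
Definition orient (R : realType) (p q z : R * R) : R :=
  (q.1 - p.1) * (z.2 - p.2) - (q.2 - p.2) * (z.1 - p.1).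

Definition cos_sin (R : realType) (t : R) : R * R := (cos t, sin t).

(** In the product form the sign can be read off. With half angles each point becomes
    [(x^2 - y^2, 2 x y)], and the determinant factors. *)
Lemma orient_cos_sin (R : realType) (a b c : R) :
  orient (cos_sin a) (cos_sin b) (cos_sin c) =
  4 * sin ((b - a) / 2) * sin ((c - b) / 2) * sin ((c - a) / 2).
Proof.
have half (x : R) : cos x = cos (x / 2) ^+ 2 - sin (x / 2) ^+ 2 /\
    sin x = 2 * sin (x / 2) * cos (x / 2).
  have -> : cos x = cos (x / 2 + x / 2) by congr cos; field.
  have -> : sin x = sin (x / 2 + x / 2) by congr sin; field.
  by rewrite cosD sinD; split; ring.
have [ca sa] := half a; have [cb sb] := half b; have [cc sc] := half c.
have sB (x y : R) : sin ((x - y) / 2) =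
    sin (x / 2) * cos (y / 2) - cos (x / 2) * sin (y / 2).
  by rewrite mulrBl sinD cosN sinN mulrN.
rewrite !sB /orient /cos_sin /= ca sa cb sb cc sc.
move: (cos2Dsin2 (a / 2)) (cos2Dsin2 (b / 2)) (cos2Dsin2 (c / 2)).
move: (cos (a / 2)) (sin (a / 2)) (cos (b / 2)) (sin (b / 2)) (cos (c / 2)).
move=> x1 y1 x2 y2 x3; move: (sin (c / 2)) => y3.
clear => h1 h2 h3.
(* Homogenized by the factors x^2+y^2 = 1, this is Vandermonde's identity. *)
transitivity
  (((x2 ^+ 2 - y2 ^+ 2) * (x1 ^+ 2 + y1 ^+ 2)
      - (x1 ^+ 2 - y1 ^+ 2) * (x2 ^+ 2 + y2 ^+ 2))
     * (2 * y3 * x3 * (x1 ^+ 2 + y1 ^+ 2) - 2 * y1 * x1 * (x3 ^+ 2 + y3 ^+ 2))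
   - (2 * y2 * x2 * (x1 ^+ 2 + y1 ^+ 2) - 2 * y1 * x1 * (x2 ^+ 2 + y2 ^+ 2))
     * ((x3 ^+ 2 - y3 ^+ 2) * (x1 ^+ 2 + y1 ^+ 2)
      - (x1 ^+ 2 - y1 ^+ 2) * (x3 ^+ 2 + y3 ^+ 2))).
  by rewrite h1 h2 h3 !mulr1.
transitivity ((x1 ^+ 2 + y1 ^+ 2) * (4 * (y2 * x1 - x2 * y1)
    * (y3 * x2 - x3 * y2) * (y3 * x1 - x3 * y1))); first by ring.
by rewrite h1 mul1r.
Qed.

(** All three half differences lie in [[0, pi]], where the sine is nonnegative. *)
Lemma orient_cos_sin_ge0 (R : realType) (a b c : R) :
  a <= b -> b <= c -> c <= a + pi *+ 2 ->
  0 <= orient (cos_sin a) (cos_sin b) (cos_sin c).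
Proof.
rewrite mulr2n => ab bc ca; rewrite orient_cos_sin.
by rewrite !mulr_ge0 ?ler0n// sin_ge0_pi//; apply/andP; split; lra.
Qed.

Lemma orient_convex (R : realType) (p q x y z : R * R) (a b c : R) :
  a + b + c = 1 ->
  orient p q (a *: x + b *: y + c *: z) =
  a * orient p q x + b * orient p q y + c * orient p q z.
Proof.
move=> abc; have -> : a = 1 - b - c by rewrite -abc; ring.
by rewrite /orient /= /GRing.scale /=; ring.
Qed.

(** Near a common interior point both inequalities hold, so the affine form vanishes there; but a
    small move by [e (A, B)] changes it by [e (A^2 + B^2)]. *)
Lemma interior_halfplanes (R : realType) (S T : set (R * R)) (A B C : R) :
  (forall z, S z -> A * z.1 + B * z.2 + C <= 0) ->
  (forall z, T z -> 0 <= A * z.1 + B * z.2 + C) ->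
  S° `&` T° !=set0 -> A = 0 /\ B = 0.
Proof.
move=> hS hT [z0 [Sz0 Tz0]].
have gc : (fun e : R => z0 + e *: ((A, B) : R * R)) @ 0 --> z0.
  rewrite [X in _ --> X](_ : z0 = z0 + (0 : R) *: ((A, B) : R * R)); last first.
    by rewrite scale0r addr0.
  apply: cvgD; first exact: cvg_cst.
  exact: (@cvgZr_tmp R (R * R)%type _ _ _ id 0 (A, B) cvg_id).
have nS : nbhs z0 (S `&` T) by exact: filterI.
have /= n0 := gc _ nS.
have zero (z : R * R) : (S `&` T) z -> A * z.1 + B * z.2 + C = 0.
  by move=> [/hS h1 /hT h2]; apply/eqP; rewrite eq_le h1 h2.
have h0 := zero _ (nbhs_singleton nS).
have [e [e0 /zero /= he]] : exists e : R, 0 < e /\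
    (S `&` T) (z0 + e *: ((A, B) : R * R)).
  have : \forall e \near (0 : R)^'+, (S `&` T) (z0 + e *: ((A, B) : R * R)).
    by have /= := cvg_at_right_filter gc nS.
  move=> h; near (0:R)^'+ => e; exists e; split => //; near: e => //.
have AB : e * (A ^+ 2 + B ^+ 2) = 0.
  move: he h0; rewrite /= /GRing.scale /= => he h0.
  by rewrite -[RHS](subrr 0) -{1}he -h0; ring.
move/eqP: AB; rewrite mulf_eq0 gt_eqF//= paddr_eq0 ?sqr_ge0// !sqrf_eq0.
by move=> /andP[/eqP -> /eqP ->].
Unshelve. all: by end_near. Qed.

(** The body of [triangle] for arbitrary points of the plane; on circle points the two are
    convertible. *)
Definition hull3 (R : realType) (p q r : R * R) : set (R * R) :=
  [set z | exists a b c : R,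
     [/\ 0 <= a, 0 <= b, 0 <= c, a + b + c = 1 & z = a *: p + b *: q + c *: r]].

Lemma orient_hull3_le0 (R : realType) (p q x y z : R * R) :
  orient p q x <= 0 -> orient p q y <= 0 -> orient p q z <= 0 ->
  forall w, hull3 x y z w -> orient p q w <= 0.
Proof.
move=> x0 y0 z0 w [a [b [c [a0 b0 c0 abc ->]]]]; rewrite orient_convex//.
by rewrite -oppr_ge0 !opprD !addr_ge0// -mulrN mulr_ge0// oppr_ge0.
Qed.

Lemma orient_hull3_ge0 (R : realType) (p q x y z : R * R) :
  0 <= orient p q x -> 0 <= orient p q y -> 0 <= orient p q z ->
  forall w, hull3 x y z w -> 0 <= orient p q w.
Proof.
move=> x0 y0 z0 w [a [b [c [a0 b0 c0 abc ->]]]]; rewrite orient_convex//.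
by rewrite !addr_ge0// mulr_ge0.
Qed.

Lemma orient_affine (R : realType) (p q z : R * R) :
  orient p q z = (p.2 - q.2) * z.1 + (q.1 - p.1) * z.2
                 + (p.1 * q.2 - p.2 * q.1).
Proof. by rewrite /orient; ring. Qed.

Lemma orient_separates (R : realType) (p q : R * R) (S T : set (R * R)) :
  p <> q -> (forall z, S z -> orient p q z <= 0) ->
  (forall z, T z -> 0 <= orient p q z) -> ~ (S° `&` T° !=set0).
Proof.
move=> pq hS hT ST; apply: pq.
have [] := interior_halfplanes (A := p.2 - q.2) (B := q.1 - p.1)
  (C := p.1 * q.2 - p.2 * q.1) _ _ ST.
- by move=> z /hS; rewrite orient_affine.
- by move=> z /hT; rewrite orient_affine.
case: p q {hS hT} => [p1 p2] [q1 q2] /= h1 h2.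
by congr pair; lra.
Qed.

(** Such a hull lies on a line, and a line separates it from itself: the line [p x] if [p <> x],
    else the vertical line through [p]. *)
Lemma interior_hull3_pxp (R : realType) (p x : R * R) : ~ ((hull3 p x p)° !=set0).
Proof.
move=> S0; have SS : (hull3 p x p)° `&` (hull3 p x p)° !=set0 by rewrite setIid.
have [px|px] := pselect (p = x).
  have S1 z : hull3 p x p z -> z = p.
    move=> [a [b [c [_ _ _ abc ->]]]].
    by rewrite -px -!scalerDl abc scale1r.
  have := interior_halfplanes (A := 1) (B := 0) (C := - p.1) _ _ SS.
  case=> [z /S1 ->|z /S1 ->|/eqP]; rewrite ?oner_eq0//; by lra.
have [p0 x0] : orient p x p = 0 /\ orient p x x = 0.
  by rewrite /orient; split; ring.
apply: (orient_separates px _ _ SS).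
  by apply: orient_hull3_le0; rewrite ?p0 ?x0.
by apply: orient_hull3_ge0; rewrite ?p0 ?x0.
Qed.

(** The chord from angle [a] to angle [c] separates the two triangles. If its endpoints coincide
    there is no such line, but then the first triangle has empty interior. *)
Lemma separated_hull3 (R : realType) (a x c d1 d2 d3 : R) :
  a <= x -> x <= c ->
  (forall d, d \in [:: d1; d2; d3] -> c <= d <= a + pi *+ 2) ->
  ~ ((hull3 (cos_sin a) (cos_sin x) (cos_sin c))° `&`
    (hull3 (cos_sin d1) (cos_sin d2) (cos_sin d3))° !=set0).
Proof.
move=> ax xc hd; have [ac|ac] := pselect (cos_sin a = cos_sin c).
  move=> [z [+ _]]; rewrite -ac => h.
  by apply: (@interior_hull3_pxp _ (cos_sin a) (cos_sin x)); exists z.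
have d_ge0 d : d \in [:: d1; d2; d3] ->
    0 <= orient (cos_sin a) (cos_sin c) (cos_sin d).
  by move=> /hd /andP[cd da]; apply: orient_cos_sin_ge0 => //; exact: le_trans xc.
apply: (orient_separates ac).
  have cpi : c <= a + pi *+ 2.
    by have /andP[] := hd d1 (mem_head _ _); exact: le_trans.
  apply: orient_hull3_le0.
  - by rewrite /orient; lra.
  (* Exchanging the last two points reverses the sign of [orient]. *)
  - have := orient_cos_sin_ge0 ax xc cpi.
    by rewrite /orient; set u := cos_sin a; set v := cos_sin x; lra.
  - by rewrite /orient; lra.
by apply: orient_hull3_ge0; apply: d_ge0; rewrite !inE eqxx ?orbT.
Qed.

Lemma sum_shift (R : zmodType) (N a : nat) (h : nat -> R) :
  (forall i, h (i + N)%N = h i) ->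
  \sum_(0 <= i < N) h (i + a)%N = \sum_(0 <= i < N) h i.
Proof.
move=> hN; elim: a => [|a IH]; first by apply: eq_bigr => i _; rewrite addn0.
rewrite -IH; case: N hN {IH} => [|N] hN; first by rewrite !big_nil.
rewrite big_nat_recr//= [RHS]big_nat_recl//= addrC; congr (_ + _).
  by rewrite -[in RHS]hN; congr h; lia.
by apply: eq_bigr => i _; congr h; lia.
Qed.

(** * Averaging over cyclic triples of pieces *)

(* [U a b] is the total weight of the triples of pieces with successive gaps
   [a], [b] and [N - a - b]. *)
Section Averaging.
Variables (R : realFieldType) (m : nat) (U : nat -> nat -> R).
Let N := m.*2.+1.
(** Total weight of the ears over sides of gap [a]. The term [x = 0] vanishes by [U0] and pads the
    sum to [a] terms, so that [e a / a] is an average. *)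
Let e (a : nat) : R := \sum_(0 <= x < a) U x (a - x)%N.
Hypothesis U_rot : forall a b, (0 < a)%N -> (0 < b)%N -> (a + b < N)%N ->
  U a b = U b (N - a - b)%N.
Hypothesis U0 : forall b, U 0%N b = 0.
Hypothesis U_clique : forall a b x y z,
  (a + b < N)%N -> (x < a)%N -> (y < b)%N -> (z < N - a - b)%N ->
  U a b + U x (a - x)%N + U y (b - y)%N + U z (N - a - b - z)%N <= N%:R.

Lemma avg_le (a : nat) (h : nat -> R) (c d : R) : (0 < a)%N ->
  (forall x, (x < a)%N -> c + h x <= d) ->
  c + (\sum_(0 <= x < a) h x) / a%:R <= d.
Proof.
move=> a0 h1; rewrite -lerBrDl ler_pdivrMr ?ltr0n// mulr_natr.
rewrite -[X in _ *+ X]subn0 -sumr_const_nat ler_sum_nat// => x /andP[_ xa].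
by rewrite lerBrDl; exact: h1.
Qed.

Lemma U_clique_avg (a b : nat) : (0 < a)%N -> (0 < b)%N -> (a + b < N)%N ->
  U a b + e a / a%:R + e b / b%:R + e (N - a - b)%N / (N - a - b)%:R <= N%:R.
Proof.
move=> a0 b0 ab.
apply: avg_le => [|z hz]; first by lia.
rewrite addrAC; apply: avg_le => // y hy.
rewrite -!addrA addrCA addrC; apply: avg_le => // x hx.
by have := U_clique ab hx hy hz; lra.
Qed.


(** Summation over the decompositions of [N] into three positive gaps, the third being
    [N - a - b]. *)
Let G (F : nat -> nat -> R) :=
  \sum_(1 <= a < N) \sum_(1 <= b < N - a) F a b.

Let GD F F' : G (fun a b => F a b + F' a b) = G F + G F'.
Proof. by rewrite /G -big_split/=; apply: eq_bigr => a _; rewrite big_split. Qed.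

Let eq_G F F' :
  (forall a b, (0 < a)%N -> (0 < b)%N -> (a + b < N)%N -> F a b = F' a b) ->
  G F = G F'.
Proof.
move=> FF'; apply: eq_big_nat => a /andP[a0 aN].
by apply: eq_big_nat => b /andP[b0 bN]; apply: FF' => //; lia.
Qed.

(** Rotating the three gaps permutes the index set: exchange the two sums and reverse the inner
    one. *)
Let G_rot F : G (fun a b => F b (N - a - b)%N) = G F.
Proof.
have wide (H : nat -> nat -> R) :
    G H = \sum_(1 <= a < N) \sum_(1 <= b < N | (a + b < N)%N) H a b.
  apply: eq_big_nat => a /andP[a0 aN]; rewrite (big_nat_widen _ _ N) ?leq_subr//.
  by apply: eq_bigl => b /=; lia.
rewrite [LHS]wide (exchange_big_dep_nat predT)//=.
apply: eq_big_nat => b /andP[b0 bN]; rewrite [RHS]big_nat_rev/=.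
rewrite [RHS](big_nat_widen _ _ N) ?leq_subr//=.
rewrite [LHS]big_nat_cond [RHS]big_nat_cond.
by apply: eq_big => [a|a ?]; [lia|congr (F _ _); lia].
Qed.

(** A first gap [a <= m] leaves exactly [a] choices for [b], those with [m - a < b <= m]. *)
Let G_fst (h : nat -> R) :
  G (fun a b => if [&& a <= m, b <= m & m < a + b]%N then h a else 0) =
  \sum_(1 <= a < m.+1) a%:R * h a.
Proof.
rewrite [RHS](big_nat_widen _ _ N) ?ltnS -?addnn ?leq_addr//= big_mkcond/=.
apply: eq_big_nat => a /andP[a0 aN]; rewrite ltnS; case: leqP => am /=; last first.
  by rewrite big1.
rewrite -big_mkcond/= mulr_natl; move: (h a) => v.
rewrite -[in RHS](_ : (m.+1 - (m.+1 - a) = a)%N); last lia.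
rewrite -sumr_const_nat [RHS](big_nat_widenl _ 1%N); last lia.
rewrite [RHS](big_nat_widen _ _ (N - a)); last by rewrite /N; lia.
rewrite [LHS]big_nat_cond [RHS]big_nat_cond.
by apply: eq_bigl => b; lia.
Qed.

(** Regroup by [s = a + b], the gap spanned by the long side of the ear. *)
Let G_ears :
  G (fun a b => if (a + b <= m)%N then U a b else 0) = \sum_(1 <= s < m.+1) e s.
Proof.
transitivity (\sum_(1 <= s < m.+1) \sum_(1 <= x < m.+1 | (x < s)%N) U x (s - x)%N).
  rewrite [RHS](exchange_big_dep_nat predT)//=.
  rewrite [RHS](big_nat_widen _ _ N)//=; last first.
    by rewrite /N -addnn; lia.
  rewrite [RHS]big_mkcond/=; apply: eq_big_nat => a /andP[a0 aN].
  rewrite -[LHS]big_mkcond/= ltnS; case: leqP => am; last first.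
    by rewrite big1// => b; lia.
  transitivity (\sum_(1 + a <= s < m.+1) U a (s - a)%N); last first.
    by rewrite [LHS](big_nat_widenl _ 1%N).
  rewrite big_addn [RHS](big_nat_widen _ _ (N - a)); last by rewrite /N; lia.
  rewrite [LHS]big_nat_cond [RHS]big_nat_cond.
  by apply: eq_big => [b|b _]; [lia|rewrite addnK].
apply: eq_big_nat => s /andP[s0 sm].
rewrite /e big_ltn// U0 add0r [RHS](big_nat_widen _ _ m.+1); last exact: ltnW.
exact: eq_bigl.
Qed.

(* The triples with all gaps at most [m] are the triangles containing the
   centre; each of the three families with a large gap is rotated to the one
   whose last gap is large. *)
Lemma sum_U_le :
  \sum_(1 <= a < N) \sum_(1 <= b < N - a) U a b <= N%:R * (m * m.+1)%:R / 2.
Proof.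
(* As [N = 2m + 1], the third gap is at most [m] exactly when [m < a + b]. *)
pose central (F : nat -> nat -> R) a b :=
  if [&& a <= m, b <= m & m < a + b]%N then F a b else 0.
pose ear a b := if (a + b <= m)%N then U a b else 0.
have ear1 : G (fun a b => if (m < a)%N then U a b else 0) = G ear.
  rewrite -[RHS]G_rot; apply: eq_G => a b a0 b0 ab; rewrite /ear.
  by rewrite -U_rot// (_ : (b + _ <= m)%N = (m < a)%N)//; rewrite /N; lia.
have ear2 : G (fun a b => if (m < b)%N then U a b else 0) = G ear.
  rewrite -ear1 -[RHS]G_rot; apply: eq_G => a b a0 b0 ab.
  by rewrite -U_rot.
(* The gaps sum to [2m + 1], so at most one of them exceeds [m] and exactly one of the four cases
   occurs. *)
have UE : G U = G (central U) + 3 * G ear.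
  transitivity (G (fun a b => central U a b
      + ((if (m < a)%N then U a b else 0) + ((if (m < b)%N then U a b else 0)
      + ear a b)))).
    apply: eq_G => a b a0 b0 ab; rewrite /central /ear.
    case: (leqP a m) => am; case: (leqP b m) => bm; case: (leqP (a + b) m) => abm /=;
      rewrite ?(addr0, add0r)//; lia.
  by rewrite !GD ear1 ear2; ring.
rewrite -[leLHS]/(G U) UE G_ears.
pose avg_sum (a b : nat) :=
  U a b + e a / a%:R + e b / b%:R + e (N - a - b)%N / (N - a - b)%:R.
have centralD F F' : G (central (fun a b => F a b + F' a b)) =
    G (central F) + G (central F').
  rewrite -GD; apply: eq_G => a b _ _ _; rewrite /central.
  by case: ifP => _; rewrite ?addr0.
have central_rot F : G (central (fun a b => F b (N - a - b)%N)) = G (central F).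
  rewrite -[RHS]G_rot; apply: eq_G => a b a0 b0 ab; rewrite /central.
  by congr (if _ then _ else _); rewrite /N; lia.
(* The weight [1 / a] cancels against the [a] central triples with first gap [a]. *)
have ce : G (central (fun a _ => e a / a%:R)) = \sum_(1 <= a < m.+1) e a.
  rewrite G_fst; apply: eq_big_nat => a /andP[a0 _].
  by rewrite mulrC divfK// pnatr_eq0; lia.
(* There are [1 + ... + m] central triples. *)
have cN : G (central (fun _ _ => N%:R)) = N%:R * (m * m.+1)%:R / 2.
  rewrite (G_fst (fun=> N%:R)) -mulr_suml -natr_sum mulrC -mulrA; congr (_ * _).
  have -> : (m * m.+1 = (\sum_(1 <= a < m.+1) a).*2)%N.
    elim: m => [|k IH]; first by rewrite big_geq.
    by rewrite big_nat_recr//= doubleD -IH; lia.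
  by rewrite -muln2 natrM mulfK.
have -> : G (central U) + 3 * \sum_(1 <= s < m.+1) e s = G (central avg_sum).
  have ce2 : G (central (fun _ b => e b / b%:R)) = \sum_(1 <= a < m.+1) e a.
    by rewrite -ce -[RHS]central_rot.
  have ce3 : G (central (fun a b => e (N - a - b)%N / (N - a - b)%:R)) =
      \sum_(1 <= a < m.+1) e a.
    by rewrite -ce2 -[RHS]central_rot.
  by rewrite /avg_sum !centralD ce ce2 ce3; ring.
rewrite -cN; apply: ler_sum_nat => a /andP[a0 aN].
apply: ler_sum_nat => b /andP[b0 bN]; rewrite /central; case: ifP => // _.
by apply: U_clique_avg => //; lia.
Qed.
End Averaging.

(** * From cyclic triples to all triples of pieces *)

Section CyclicTripleSum.
Variables (R : realFieldType) (m : nat) (M : nat -> nat -> nat -> R).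
Let N := m.*2.+1.
Hypothesis M_itv : forall i j k, 0 <= M i j k <= 1.
Hypothesis M_swap12 : forall i j k, M j i k = M i j k.
Hypothesis M_swap23 : forall i j k, M i k j = M i j k.
Hypothesis M_period : forall i j k, M i j (k + N)%N = M i j k.
Hypothesis M_clique : forall i a b x y z,
  (a + b < N)%N -> (x < a)%N -> (y < b)%N -> (z < N - a - b)%N ->
  M i (i + a) (i + a + b)
  + (0 < x)%N%:R * M i (i + a) (i + x)
  + (0 < y)%N%:R * M (i + a) (i + a + b) (i + a + y)
  + (0 < z)%N%:R * M i (i + a + b) (i + a + b + z) <= 1.

Let M_period1 i j k : M (i + N) j k = M i j k.
Proof. by rewrite -M_swap12 -M_swap23 M_period M_swap23 M_swap12. Qed.

Let M_period2 i j k : M i (j + N) k = M i j k.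
Proof. by rewrite -M_swap23 M_period M_swap23. Qed.

Let M_rot i j k : M j k i = M i j k.
Proof. by rewrite M_swap23 M_swap12. Qed.

Let W (a b : nat) : R := \sum_(0 <= i < N) M i (i + a) (i + b).

Let W_shift c a b :
  W a b = \sum_(0 <= i < N) M (i + c) (i + c + a) (i + c + b).
Proof.
apply/esym/(sum_shift c (h := fun i => M i (i + a)%N (i + b)%N)) => i.
by rewrite M_period1 -[(i + N + a)%N]addnAC M_period2
  -[(i + N + b)%N]addnAC M_period.
Qed.

Let W_sym a b : W a b = W b a.
Proof. by apply: eq_bigr => i _; rewrite M_swap23. Qed.

Let W_itv a b : 0 <= W a b <= N%:R.
Proof.
apply/andP; split.
  by apply: sumr_ge0 => i _; have /andP[] := M_itv i (i + a) (i + b).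
rewrite -[X in _ <= X%:R]subn0 -[leRHS]/(1 *+ (N - 0)) -sumr_const_nat.
by apply: ler_sum => i _; have /andP[] := M_itv i (i + a) (i + b).
Qed.

(** The boolean factor discards triples in which a gap [a] or [b] is zero, as [U0] demands. *)
Let U (a b : nat) : R := ((0 < a)%N && (0 < b)%N)%:R * W a (a + b).

(** Take the second piece as base point; the last offset then wraps round to [i + N]. *)
Let U_rot a b : (0 < a)%N -> (0 < b)%N -> (a + b < N)%N ->
  U a b = U b (N - a - b)%N.
Proof.
move=> a0 b0 ab; rewrite /U a0 b0 (_ : (0 < N - a - b)%N = true); last lia.
rewrite !mul1r (W_shift a b); apply: eq_bigr => i _.
rewrite (_ : (i + a + (b + (N - a - b)) = i + N)%N); last lia.
by rewrite M_period M_rot addnA.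
Qed.

Let U_clique a b x y z :
  (a + b < N)%N -> (x < a)%N -> (y < b)%N -> (z < N - a - b)%N ->
  U a b + U x (a - x)%N + U y (b - y)%N + U z (N - a - b - z)%N <= N%:R.
Proof.
move=> ab xa yb zc.
(* Each ear is rebased at the start [c] of its side, so that all four sums run over the same [i] and
   [M_clique] applies termwise. *)
have UE c u v : (u < v)%N -> U u (v - u)%N =
    \sum_(0 <= i < N) (0 < u)%N%:R * M (i + c) (i + c + v) (i + c + u).
  move=> uv; rewrite /U subn_gt0 uv andbT subnKC ?(ltnW uv)// (W_shift c).
  by rewrite mulr_sumr; apply: eq_bigr => i _; rewrite M_swap23.
rewrite (UE 0%N _ _ xa) (UE a _ _ yb) (UE (a + b)%N _ _ zc).
rewrite {1}/U (_ : (0 < a)%N && (0 < b)%N); last lia.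
rewrite mul1r -!big_split/= -[X in _ <= X%:R]subn0 -[leRHS]/(1 *+ (N - 0)).
rewrite -sumr_const_nat; apply: ler_sum => i _.
apply: le_trans (M_clique i ab xa yb zc).
rewrite !addn0 !addnA (_ : (i + a + b + (N - a - b) = i + N)%N); last lia.
by rewrite M_period2 (M_swap12 i).
Qed.

Lemma sum_triples_le :
  \sum_(0 <= i < N) \sum_(0 <= j < N) \sum_(0 <= k < N) M i j k
  <= N%:R * (m * m.+1)%:R + 3 * N%:R ^+ 2.
Proof.
(* By periodicity the last two indices may be counted as offsets from the first. *)
have -> : \sum_(0 <= i < N) \sum_(0 <= j < N) \sum_(0 <= k < N) M i j k =
    \sum_(0 <= a < N) \sum_(0 <= b < N) W a b.
  transitivity (\sum_(0 <= i < N) \sum_(0 <= a < N) \sum_(0 <= b < N)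
    M i (i + a) (i + b)).
    apply: eq_bigr => i _.
    rewrite -(sum_shift i (h := fun j => \sum_(0 <= k < N) M i j k)).
      apply: eq_bigr => a _; rewrite -(sum_shift i)//.
      by apply: eq_bigr => b _; rewrite ![(_ + i)%N]addnC.
    by move=> j; apply: eq_bigr => k _; rewrite M_period2.
  rewrite exchange_big/=; apply: eq_bigr => a _.
  by rewrite exchange_big.
(* [V a b] keeps one cyclic orientation; the symmetry of [W] makes [V b a] account for the other. *)
pose V a b := (0 < a < b)%N%:R * W a b.
have half : \sum_(0 <= a < N) \sum_(0 <= b < N) V a b <= N%:R * (m * m.+1)%:R / 2.
  apply: le_trans (sum_U_le U_rot _ U_clique); last first.
    by move=> b; rewrite /U mul0r.
  rewrite [leLHS]big_ltn// [X in X + _]big1 ?add0r; last first.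
    by move=> b _; rewrite /V mul0r.
  apply: ler_sum_nat => a /andP[a0 aN].
  rewrite (@big_cat_nat _ _ _ a.+1)//= [X in X + _]big1_seq ?add0r; last first.
    by move=> b; rewrite mem_index_iota /= ltnS /V a0 /= ltnNge => ->; rewrite mul0r.
  rewrite -[a.+1]add1n -[in leLHS]addn1 addn1 big_addn.
  apply: ler_sum_nat => b /andP[b0 bN].
  by rewrite /V /U a0 b0 (_ : (a < b + a)%N) ?(addnC b)//; lia.
(* Each of the three kinds of coincidence occurs for [N] pairs of offsets, and [W <= N]; this gives
   the error [3 N^2]. *)
have W_le a b : W a b <= V a b + V b a
    + ((a == 0%N)%:R + (b == 0%N)%:R + (a == b)%:R) * N%:R.
  rewrite /V (W_sym b a); have /andP[W0 WN] := W_itv a b.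
  have N0 : 0 <= N%:R :> R by [].
  have [a_0|a0] := posnP a.
    by subst a; case: b W0 WN => [|b] W0 WN; rewrite ?eqxx /=; lra.
  have [b_0|b0] := posnP b.
    by subst b; rewrite !ltn0 ?andbF (gtn_eqF a0) /=; lra.
  by case: ltngtP => ab; rewrite ?a0 ?b0 ?(gtn_eqF a0) ?(gtn_eqF b0) /=; lra.
apply: (@le_trans _ _ (\sum_(0 <= a < N) \sum_(0 <= b < N) (V a b + V b a
    + ((a == 0%N)%:R + (b == 0%N)%:R + (a == b)%:R) * N%:R))).
  by apply: ler_sum => a _; apply: ler_sum => b _; exact: W_le.
have sumD (G H : nat -> nat -> R) :
    \sum_(0 <= a < N) \sum_(0 <= b < N) (G a b + H a b) =
    \sum_(0 <= a < N) \sum_(0 <= b < N) G a b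
    + \sum_(0 <= a < N) \sum_(0 <= b < N) H a b.
  by rewrite -big_split; apply: eq_bigr => a _; rewrite big_split.
have diag c : (c < N)%N -> \sum_(0 <= b < N) (c == b)%:R = 1 :> R.
  move=> cN; rewrite (bigD1_seq c) ?iota_uniq ?mem_index_iota//= eqxx.
  by rewrite big1 ?addr0// => b; rewrite eq_sym => /negbTE ->.
have sum1 : \sum_(0 <= b < N) 1 = N%:R :> R by rewrite sumr_const_nat subn0.
rewrite !sumD [X in _ + X + _]exchange_big/=.
suff -> : \sum_(0 <= a < N) \sum_(0 <= b < N)
    ((a == 0%N)%:R + (b == 0%N)%:R + (a == b)%:R) * N%:R = 3 * N%:R ^+ 2 :> R.
  by lra.
transitivity ((\sum_(0 <= a < N) \sum_(0 <= b < N)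
    ((a == 0%N)%:R + (b == 0%N)%:R + (a == b)%:R)) * N%:R : R).
  by rewrite mulr_suml; apply: eq_bigr => a _; rewrite mulr_suml.
rewrite !sumD.
have -> : \sum_(0 <= a < N) \sum_(0 <= b < N) (a == 0%N)%:R = N%:R :> R.
  rewrite exchange_big/= -[RHS]sum1; apply: eq_bigr => b _.
  rewrite -[RHS](diag 0%N)//.
  by apply: eq_bigr => a _; rewrite eq_sym.
have -> : \sum_(0 <= a < N) \sum_(0 <= b < N) (b == 0%N)%:R = N%:R :> R.
  rewrite -[RHS]sum1; apply: eq_bigr => b _; rewrite -[RHS](diag 0%N)//.
  by apply: eq_bigr => a _; rewrite eq_sym.
have -> : \sum_(0 <= a < N) \sum_(0 <= b < N) (a == b)%:R = N%:R :> R.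
  by rewrite -[RHS]sum1; apply: eq_big_nat => a /andP[_ aN]; rewrite diag.
by ring.
Qed.
End CyclicTripleSum.

(** * Iterated integrals and mixtures *)

(** Carries the measurability proof explicitly, so that indexed families of image measures can be
    summed by [msum]. *)
Definition image_measure d d' (T : measurableType d) (X : measurableType d')
  (R : realType) (m : {measure set T -> \bar R}) (f : T -> X)
  (mf : measurable_fun setT f) : {measure set X -> \bar R}.
Proof. by refine (pushforward m f : {measure set X -> \bar R}). Defined.

Section IteratedIntegral.
Context d (T : measurableType d) (R : realType) (P : probability T R).
Local Open Scope ereal_scope.

Definition integral3 (h : T -> T -> T -> \bar R) : \bar R :=
  \int[P]_u \int[P]_v \int[P]_w h u v w.

Definition jointly_measurable (h : T -> T -> T -> \bar R) :=
  measurable_fun setT (fun z : T * T * T => h z.1.1 z.1.2 z.2).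

Lemma measurable_integral3_in (h : T -> T -> T -> \bar R) :
  jointly_measurable h -> (forall u v w, 0 <= h u v w) ->
  [/\ forall u v, measurable_fun setT (h u v),
      measurable_fun setT (fun z : T * T => \int[P]_w h z.1 z.2 w),
      (forall u, measurable_fun setT (fun v => \int[P]_w h u v w)) &
      measurable_fun setT (fun u => \int[P]_v \int[P]_w h u v w)].
Proof.
move=> mh h0.
have m2 : measurable_fun setT (fun z : T * T => \int[P]_w h z.1 z.2 w).
  exact: (measurable_fun_fubini_tonelli_F (m2 := P) _ mh (fun=> h0 _ _ _)).
split => //.
- move=> u v; exact: (measurableT_comp mh (measurable_pair1 (u, v))).
- move=> u; exact: (measurableT_comp m2 (measurable_pair1 u)).
- apply: (measurable_fun_fubini_tonelli_F (m2 := P) _ m2) => x.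
  exact: integral_ge0.
Qed.

Lemma integral_cst_prob (c : \bar R) : \int[P]_u (fun=> c) u = c.
Proof.
rewrite integral_cst// -[RHS]mule1; congr (_ * _); exact: probability_setT.
Qed.

Lemma integral_sum4_le1 (f1 f2 f3 f4 : T -> \bar R) :
  measurable_fun setT f1 -> measurable_fun setT f2 ->
  measurable_fun setT f3 -> measurable_fun setT f4 ->
  (forall u, 0 <= f1 u) -> (forall u, 0 <= f2 u) ->
  (forall u, 0 <= f3 u) -> (forall u, 0 <= f4 u) ->
  (forall u, f1 u + f2 u + f3 u + f4 u <= 1) ->
  \int[P]_u f1 u + \int[P]_u f2 u + \int[P]_u f3 u + \int[P]_u f4 u <= 1.
Proof.
move=> m1 m2 m3 m4 p1 p2 p3 p4 f1234.
have p12 u : 0 <= f1 u + f2 u by rewrite adde_ge0.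
have m12 : measurable_fun setT (fun u => f1 u + f2 u) by exact: emeasurable_funD.
have p123 u : 0 <= f1 u + f2 u + f3 u by rewrite adde_ge0.
have m123 : measurable_fun setT (fun u => f1 u + f2 u + f3 u).
  exact: emeasurable_funD.
rewrite -!ge0_integralD//.
rewrite -[leRHS]integral_cst_prob.
apply: ge0_le_integral => //; first by move=> u _; rewrite adde_ge0.
exact: emeasurable_funD.
Qed.

(** Integrate the pointwise inequality over [x], [r], [q] and [p] in turn. Each integration leaves
    exactly one of the four terms constant, and a probability preserves constants. By linearity one
    variable [x] can serve as apex of all three ears. *)
Lemma integral3_clique (h1 h2 h3 h4 : T -> T -> T -> \bar R) :
  jointly_measurable h1 -> jointly_measurable h2 ->
  jointly_measurable h3 -> jointly_measurable h4 ->
  (forall u v w, 0 <= h1 u v w) -> (forall u v w, 0 <= h2 u v w) ->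
  (forall u v w, 0 <= h3 u v w) -> (forall u v w, 0 <= h4 u v w) ->
  (forall p q r x, h1 p q r + h2 p q x + h3 q r x + h4 p r x <= 1) ->
  integral3 h1 + integral3 h2 + integral3 h3 + integral3 h4 <= 1.
Proof.
move=> m1 m2 m3 m4 p1 p2 p3 p4 le1; rewrite /integral3.
have [m11 m12 m13 m14] := measurable_integral3_in m1 p1.
have [m21 m22 m23 m24] := measurable_integral3_in m2 p2.
have [m31 m32 m33 m34] := measurable_integral3_in m3 p3.
have [m41 m42 m43 m44] := measurable_integral3_in m4 p4.
have ge0 : forall h : T -> T -> T -> \bar R, (forall u v w, 0 <= h u v w) ->
    (forall u v, 0 <= \int[P]_w h u v w) /\
    (forall u, 0 <= \int[P]_v \int[P]_w h u v w).
  by move=> h h0; split=> *; do ?[apply: integral_ge0 => *].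
have [q1 r1] := ge0 _ p1; have [q2 r2] := ge0 _ p2.
have [q3 r3] := ge0 _ p3; have [q4 r4] := ge0 _ p4.
have i3 : 0 <= \int[P]_u \int[P]_v \int[P]_w h3 u v w.
  by apply: integral_ge0 => u _.
have mcst (c : \bar R) : measurable_fun [set: T] (fun=> c) by exact: measurable_cst.
(* Rewriting with [integral_cst_prob] would compare it with every integral. *)
have subst4 (s1 s2 s3 s4 t1 t2 t3 t4 : \bar R) : s1 = t1 -> s2 = t2 ->
    s3 = t3 -> s4 = t4 -> s1 + s2 + s3 + s4 <= 1 -> t1 + t2 + t3 + t4 <= 1.
  by move=> -> -> -> ->.
have step1 p q r : h1 p q r + \int[P]_x h2 p q x + \int[P]_y h3 q r y
    + \int[P]_z h4 p r z <= 1.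
  apply: (subst4 _ _ _ _ _ _ _ _ (integral_cst_prob _) erefl erefl erefl).
  exact: (integral_sum4_le1 (mcst (h1 p q r)) (m21 p q) (m31 q r) (m41 p r)
    (fun=> p1 p q r) (p2 p q) (p3 q r) (p4 p r) (le1 p q r)).
have step2 p q : \int[P]_r h1 p q r + \int[P]_x h2 p q x
    + \int[P]_r \int[P]_y h3 q r y + \int[P]_r \int[P]_z h4 p r z <= 1.
  apply: (subst4 _ _ _ _ _ _ _ _ erefl (integral_cst_prob _) erefl erefl).
  exact: (integral_sum4_le1 (m11 p q) (mcst (\int[P]_x h2 p q x)) (m33 q)
    (m43 p) (p1 p q) (fun=> q2 p q) (q3 q) (q4 p) (step1 p q)).
have step3 p : \int[P]_q \int[P]_r h1 p q r + \int[P]_q \int[P]_x h2 p q x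
    + \int[P]_q \int[P]_r \int[P]_y h3 q r y
    + \int[P]_r \int[P]_z h4 p r z <= 1.
  apply: (subst4 _ _ _ _ _ _ _ _ erefl erefl erefl (integral_cst_prob _)).
  exact: (integral_sum4_le1 (m13 p) (m23 p) m34
    (mcst (\int[P]_r \int[P]_z h4 p r z))
    (q1 p) (q2 p) r3 (fun=> r4 p) (step2 p)).
apply: (subst4 _ _ _ _ _ _ _ _ erefl erefl (integral_cst_prob _) erefl).
exact: (integral_sum4_le1 m14 m24
  (mcst (\int[P]_q \int[P]_r \int[P]_y h3 q r y)) m44
  r1 r2 (fun=> i3) r4 step3).
Qed.

Lemma integral3_swap23 (h : T -> T -> T -> \bar R) :
  jointly_measurable h -> (forall u v w, 0 <= h u v w) ->
  integral3 (fun u v w => h u w v) = integral3 h.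
Proof.
move=> mh h0; apply: eq_integral => u _.
rewrite (fubini_tonelli (m1 := P) (m2 := P) (fun z => h u z.2 z.1))//.
pose s (z : T * T) := (u, z.2, z.1).
have ms : measurable_fun setT s.
  apply: measurable_fun_pair; last exact: measurable_fst.
  by apply: measurable_fun_pair; [exact: measurable_cst|exact: measurable_snd].
exact: (measurableT_comp mh ms).
Qed.

Lemma integral3_swap12 (h : T -> T -> T -> \bar R) :
  jointly_measurable h -> (forall u v w, 0 <= h u v w) ->
  integral3 (fun u v w => h v u w) = integral3 h.
Proof.
move=> mh h0; have [_ m2 _ _] := measurable_integral3_in mh h0.
rewrite /integral3 [RHS](fubini_tonelli (m1 := P) (m2 := P)
  (fun z => \int[P]_w h z.1 z.2 w))//.
by move=> z; exact: integral_ge0.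
Qed.


(** The upper bound is [integral3_clique] with three zero functions. *)
Lemma integral3_le1 (h : T -> T -> T -> \bar R) :
  jointly_measurable h -> (forall u v w, 0 <= h u v w <= 1) -> 0 <= integral3 h <= 1.
Proof.
move=> mh h01; have h0 u v w : 0 <= h u v w by have /andP[] := h01 u v w.
apply/andP; split; first by do 3 apply: integral_ge0 => ? _.
have m0 : jointly_measurable (fun _ _ _ => 0) by exact: measurable_cst.
have i0 : integral3 (fun _ _ _ => 0) = 0.
  by rewrite /integral3 !integral_cst_prob.
have := integral3_clique mh m0 m0 m0; rewrite i0 !adde0; apply => //.
by move=> p q r _; rewrite !adde0; have /andP[] := h01 p q r.
Qed.
End IteratedIntegral.

(** * Integration against an average of image measures *)

Section Mixture.
Context d d' (T : measurableType d) (X : measurableType d') (R : realType).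
Context (P : probability T R) (nu : probability X R) (N : nat).
Variable g : nat -> T -> X.
Hypothesis mg : forall i, measurable_fun setT (g i).
Hypothesis nuE : forall A, measurable A ->
  (N%:R%:E * nu A = \sum_(i < N) P (g i @^-1` A))%E.
Local Open Scope ereal_scope.

(** By [nuE] the measure [N nu] is the sum of the images of [P] under the [g i]; what remains is
    change of variables. *)
Lemma integral_mixture (f : X -> \bar R) :
  measurable_fun setT f -> (forall x, 0 <= f x) ->
  N%:R%:E * \int[nu]_x f x = \sum_(i < N) \int[P]_u f (g i u).
Proof.
move=> mf f0.
pose Pg i := image_measure P (mg i).
have := @ge0_integral_measure_sum _ _ _ Pg setT measurableT f (fun x _ => f0 x) mf N.
have <- : \int[mscale (NngNum (ler0n R N)) nu]_x f x = \int[msum Pg N]_x f x.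
  apply: eq_measure_integral => A mA _.
  exact: (nuE mA).
rewrite ge0_integral_mscale// => ->; apply: eq_bigr => i _.
by rewrite ge0_integral_pushforward.
Qed.
End Mixture.

Section ProductMixture.
Context d d' (T : measurableType d) (X : measurableType d') (R : realType).
Context (P : probability T R) (nu : probability X R) (N : nat).
Variable g : nat -> T -> X.
Hypothesis mg : forall i, measurable_fun setT (g i).
Hypothesis nuE : forall A, measurable A ->
  (N%:R%:E * nu A = \sum_(i < N) P (g i @^-1` A))%E.
Variable S : set (X * X * X).
Hypothesis mS : measurable S.
Local Open Scope ereal_scope.

Definition cell_indic (i j k : nat) (u v w : T) : \bar R :=
  (\1_S (g i u, g j v, g k w))%:E.

Lemma measurable_cell_indic i j k :
  measurable_fun setT (fun z : T * T * T => cell_indic i j k z.1.1 z.1.2 z.2).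
Proof.
apply/measurable_EFinP.
pose s (z : T * T * T) := (g i z.1.1, g j z.1.2, g k z.2).
have ms : measurable_fun setT s.
  apply: measurable_fun_pair; first apply: measurable_fun_pair.
  - apply: measurableT_comp => //; apply: measurableT_comp => //.
  - apply: measurableT_comp => //; apply: measurableT_comp => //.
  - by apply: measurableT_comp.
exact: (measurableT_comp (measurable_indic mS) ms).
Qed.

(** The product measure is an iterated integral by Tonelli, and [integral_mixture] is applied once
    in each variable. *)
Lemma product3_mixture :
  N%:R%:E * (N%:R%:E * (N%:R%:E * ((nu \x nu) \x nu) S)) =
  \sum_(i < N) \sum_(j < N) \sum_(k < N) integral3 P (cell_indic i j k).
Proof.
pose f (x y z : X) : \bar R := (\1_S (x, y, z))%:E.
have mf : measurable_fun setT (fun z : X * X * X => f z.1.1 z.1.2 z.2).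
  apply/measurable_EFinP; rewrite (_ : (fun _ => _) = \1_S).
    exact: measurable_indic.
  by apply/funext => -[[]].
have f0 x y z : 0 <= f x y z by rewrite lee_fin.
have [m1 m2 m3 m4] := measurable_integral3_in  nu mf f0.
have muE : ((nu \x nu) \x nu) S = integral3 nu f.
  rewrite -[LHS]/(\int[nu \x nu]_z (nu \o xsection S) z) /integral3.
  rewrite -[RHS](fubini_tonelli1 (m1 := nu) (m2 := nu)
    (fun z => \int[nu]_w f z.1 z.2 w))//; last first.
    by move=> z; exact: integral_ge0.
  apply: eq_integral => -[x y] _ /=.
  transitivity (\int[nu]_w (\1_(xsection S (x, y)) w)%:E).
    by rewrite integral_indic ?setIT//; exact: measurable_xsection.
  apply: eq_integral => w _; rewrite /f !indicE; congr (_%:R%:E).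
  by rewrite mem_xsection.
have mix (h : X -> \bar R) : measurable_fun setT h -> (forall x, 0 <= h x) ->
    N%:R%:E * \int[nu]_x h x = \sum_(i < N) \int[P]_u h (g i u).
  exact: integral_mixture.
have q2 x y : 0 <= \int[nu]_z f x y z by exact: integral_ge0.
have q3 x : 0 <= \int[nu]_y \int[nu]_z f x y z by exact: integral_ge0.
have N0 : 0 <= N%:R%:E :> \bar R by rewrite lee_fin.
have mgi (h : X -> \bar R) i : measurable_fun setT h ->
    measurable_fun setT (fun u => h (g i u)).
  by move=> mh; exact: measurableT_comp.
have step (p : X) : N%:R%:E * (N%:R%:E * \int[nu]_y \int[nu]_z f p y z) =
    \sum_(j < N) \int[P]_v \sum_(k < N) \int[P]_w f p (g j v) (g k w).
  rewrite -ge0_integralZl// mix//; last 2 first.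
  - exact: measurable_funeM.
  - by move=> y; exact: mule_ge0.
  by apply: eq_bigr => j _; apply: eq_integral => v _; rewrite mix.
have -> : N%:R%:E * (N%:R%:E * ((nu \x nu) \x nu) S) =
    \int[nu]_x (N%:R%:E * (N%:R%:E * \int[nu]_y \int[nu]_z f x y z)).
  rewrite muE ge0_integralZl//; last 2 first.
  - exact: measurable_funeM.
  - by move=> x _; exact: mule_ge0.
  by rewrite ge0_integralZl.
rewrite mix; last 2 first.
- by do 2 apply: measurable_funeM.
- by move=> x; do 2 apply: mule_ge0 => //.
apply: eq_bigr => i _.
have c0 j k u v w : 0 <= cell_indic i j k u v w by rewrite lee_fin.
have mc j k := measurable_integral3_in P (measurable_cell_indic i j k) (c0 j k).
transitivity (\int[P]_u \sum_(j < N) \sum_(k < N)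
    \int[P]_v \int[P]_w cell_indic i j k u v w).
  apply: eq_integral => u _; rewrite step; apply: eq_bigr => j _.
  rewrite -ge0_integral_sum//.
  - by move=> k; have [_ _ /(_ u)] := mc j k.
  - by move=> k v _; exact: integral_ge0.
rewrite ge0_integral_sum//; last 2 first.
- move=> j; apply: emeasurable_sum => k; by have [_ _ _] := mc j k.
- by move=> j u _; apply: sume_ge0 => k _; do 2 apply: integral_ge0 => ? _.
apply: eq_bigr => j _; rewrite ge0_integral_sum//.
- by move=> k; have [_ _ _] := mc j k.
- by move=> k u _; do 2 apply: integral_ge0 => ? _.
Qed.
End ProductMixture.

(** * Angles, quantiles and pieces *)

Section Angle.
Variable R : realType.

Lemma cos_sin_in_circle (t : R) : (cos_sin t : R * R) \in @unit_circle R.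
Proof. by rewrite inE /unit_circle/= cos2Dsin2. Qed.

Definition arg_point (t : R) : circle R := exist _ (cos_sin t) (cos_sin_in_circle t).

(** A right inverse of [arg_point]: the arc cosine on the upper half circle, reflected on the lower
    one. *)
Definition angle (p : circle R) : R :=
  if 0 <= (circle_val p).2 then acos (circle_val p).1
  else pi *+ 2 - acos (circle_val p).1.

Lemma circle_valP (p : circle R) : (circle_val p).1 ^+ 2 + (circle_val p).2 ^+ 2 = 1.
Proof. by case: p => x xP; exact: (set_mem xP). Qed.

Lemma circle_val1 (p : circle R) : -1 <= (circle_val p).1 <= 1.
Proof.
have := circle_valP p; set x := (circle_val p).1; set y := (circle_val p).2 => h.
by apply/andP; split; nra.
Qed.

Lemma angle_itv (p : circle R) : 0 <= angle p <= pi *+ 2.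
Proof.
have x1 := circle_val1 p; have := acos_ge0 x1; have := acos_lepi x1.
have := pi_ge0 R; rewrite /angle mulr2n; case: ifP => _; lra.
Qed.

Lemma angleK (p : circle R) : arg_point (angle p) = p.
Proof.
have x1 := circle_val1 p; have h := circle_valP p.
have x1' : (circle_val p).1 \in `[-1, 1] by rewrite in_itv.
apply: val_inj; rewrite /= /cos_sin /angle -/(circle_val p).
have sq : Num.sqrt (1 - (circle_val p).1 ^+ 2) = `|(circle_val p).2|.
  by rewrite -h addrAC subrr add0r sqrtr_sqr.
rewrite [RHS]surjective_pairing; case: ifPn => y0.
  by rewrite acosK// sin_acos// sq ger0_norm.
rewrite addrC cosD2pi sinD2pi cosN sinN acosK// sin_acos// sq ler0_norm ?opprK//.
by rewrite ltW// ltNge.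
Qed.

Lemma measurable_circle_val : measurable_fun setT
  (@circle_val R : circle R -> measurableTypeR R * measurableTypeR R).
Proof. by move=> _ B mB; exists B. Qed.

Lemma measurable_arg_point :
  measurable_fun setT (arg_point : measurableTypeR R -> circle R).
Proof.
move=> _ _ [B mB <-]; rewrite !setTI.
have mcs : measurable_fun setT
    (@cos_sin R : measurableTypeR R -> measurableTypeR R * measurableTypeR R).
  apply/measurable_fun_pairP; split.
  - by apply: continuous_measurable_fun; exact: continuous_cos.
  - by apply: continuous_measurable_fun; exact: continuous_sin.
by rewrite -[X in measurable X]setTI; exact: mcs.
Qed.

Lemma measurable_angle : measurable_fun setT (angle : circle R -> measurableTypeR R).
Proof.
have [mx my] := (measurable_fun_pairP _).1 measurable_circle_val.
have macos : measurable_fun `[(-1 : R), 1] (@acos R).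
  (* Continuity on the open interval suffices, since adding two endpoints preserves
     measurability. *)
  apply: (@measurable_fun_itv_cc R _ _ false true).
  apply: open_continuous_measurable_fun => //.
  by move=> x; rewrite inE/= in_itv/= => /continuous_acos.
have mac : measurable_fun setT
    (fun p : circle R => acos (circle_val p).1 : measurableTypeR R).
  apply: (measurable_comp _ _ macos mx) => //.
  by move=> _ [p _ <-] /=; rewrite in_itv; exact: circle_val1.
apply: measurable_fun_ifT => //.
- by apply: measurable_fun_ler => //; exact: measurable_cst.
- by apply: measurable_funB => //; exact: measurable_cst.
Qed.
End Angle.

Lemma arg_pointD2pi (R : realType) (t : R) : arg_point (t + pi *+ 2) = arg_point t.
Proof. by apply: val_inj; rewrite /= /cos_sin cosD2pi sinD2pi. Qed.

(** * A triangle and its three ears in a symmetric intersecting family *)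

Lemma sum4_bool_le1 (b1 b2 b3 b4 : bool) :
  (b1 -> b2 -> False) -> (b1 -> b3 -> False) -> (b1 -> b4 -> False) ->
  (b2 -> b3 -> False) -> (b2 -> b4 -> False) -> (b3 -> b4 -> False) ->
  (b1 + b2 + b3 + b4 <= 1)%N.
Proof.
case: b1 b2 b3 b4 => [] [] [] [] // h12 h13 h14 h23 h24 h34;
  by [case: h12|case: h13|case: h14|case: h23|case: h24|case: h34].
Qed.

Section SymmetricFamily.
Variables (R : realType) (F : set (triangle_space R)).
Hypothesis F_int : intersecting_family F.
Hypothesis F_swap12 : forall p q r, F (p, q, r) -> F (q, p, r).
Hypothesis F_swap23 : forall p q r, F (p, q, r) -> F (p, r, q).

Lemma not_both_in_family (a x c d1 d2 d3 : R) : a <= x -> x <= c ->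
  (forall d, d \in [:: d1; d2; d3] -> c <= d <= a + pi *+ 2) ->
  F (arg_point a, arg_point x, arg_point c) ->
  ~ F (arg_point d1, arg_point d2, arg_point d3).
Proof. by move=> ax xc hd F1 /(F_int F1); exact: separated_hull3. Qed.

Let Fb (a b c : R) := (arg_point a, arg_point b, arg_point c) \in F.

(** Each of the six pairs is separated by a chord, once some vertices are shifted by a full turn,
    which does not move the points, and reordered by symmetry. The booleans switch off ears whose
    apex has no known position on its arc. *)
Lemma family_clique (a b c x y z : R) (ex ey ez : bool) :
  a <= b -> b <= c -> c <= a + pi *+ 2 ->
  (ex -> a <= x <= b) -> (ey -> b <= y <= c) ->
  (ez -> c <= z <= a + pi *+ 2) ->
  (Fb a b c + (ex && Fb a b x) + (ey && Fb b c y) + (ez && Fb a c z) <= 1)%N.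
Proof.
move=> ab bc ca hx hy hz.
have p2 := pi_ge0 R.
have hd (u v d1 d2 d3 : R) : u <= d1 <= v -> u <= d2 <= v -> u <= d3 <= v ->
    forall d, d \in [:: d1; d2; d3] -> u <= d <= v.
  by move=> h1 h2 h3 d; rewrite !inE => /or3P[] /eqP ->.
have FP (u v w : R) : Fb u v w -> F (arg_point u, arg_point v, arg_point w).
  by rewrite /Fb inE.
have n12 : Fb a b c -> ex && Fb a b x -> False.
  move=> /FP F1 /andP[/hx /andP[lo hi] /FP F2].
  apply: (@not_both_in_family a x b (a + pi *+ 2) b c) => //.
  - by apply: hd; apply/andP; split;
    move: (pi *+ 2) p2 ab bc ca lo hi; clear=> *; lra.
  - exact: F_swap23.
  - by rewrite arg_pointD2pi.
have n13 : Fb a b c -> ey && Fb b c y -> False.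
  move=> /FP F1 /andP[/hy /andP[lo' hi'] /FP F2].
  apply: (@not_both_in_family b y c (a + pi *+ 2) (b + pi *+ 2) c) => //.
  - by apply: hd; apply/andP; split;
    move: (pi *+ 2) p2 ab bc ca lo' hi'; clear=> *; lra.
  - exact: F_swap23.
  - by rewrite !arg_pointD2pi.
have n14 : Fb a b c -> ez && Fb a c z -> False.
  move=> /FP F1 /andP[/hz /andP[lo' hi'] /FP F2].
  (* The arc of this ear runs from [c] to [a + 2 pi], so the triangle [a b c] is moved by a full
     turn to lie beyond it. *)
  apply: (@not_both_in_family c z (a + pi *+ 2)
    (a + pi *+ 2) (b + pi *+ 2) (c + pi *+ 2)) => //.
  - by apply: hd; apply/andP; split;
    move: (pi *+ 2) p2 ab bc ca lo' hi'; clear=> *; lra.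
  - rewrite arg_pointD2pi; exact/F_swap23/F_swap12.
  - by rewrite !arg_pointD2pi.
have n23 : ex && Fb a b x -> ey && Fb b c y -> False.
  move=> /andP[/hx /andP[lo hi] /FP F1] /andP[/hy /andP[lo' hi'] /FP F2].
  apply: (@not_both_in_family a x b b c y) => //; last exact: F_swap23.
  by apply: hd; apply/andP; split;
    move: (pi *+ 2) p2 ab bc ca lo hi lo' hi'; clear=> *; lra.
have n24 : ex && Fb a b x -> ez && Fb a c z -> False.
  move=> /andP[/hx /andP[lo hi] /FP F1] /andP[/hz /andP[lo' hi'] /FP F2].
  apply: (@not_both_in_family a x b (a + pi *+ 2) c z) => //.
  - by apply: hd; apply/andP; split;
    move: (pi *+ 2) p2 ab bc ca lo hi lo' hi'; clear=> *; lra.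
  - exact: F_swap23.
  - by rewrite arg_pointD2pi.
have n34 : ey && Fb b c y -> ez && Fb a c z -> False.
  move=> /andP[/hy /andP[lo hi] /FP F1] /andP[/hz /andP[lo' hi'] /FP F2].
  apply: (@not_both_in_family b y c (a + pi *+ 2) c z) => //.
  - by apply: hd; apply/andP; split;
    move: (pi *+ 2) p2 ab bc ca lo hi lo' hi'; clear=> *; lra.
  - exact: F_swap23.
  - by rewrite arg_pointD2pi.
exact: sum4_bool_le1.
Qed.
End SymmetricFamily.

(** * Quantiles of a bounded random variable and the pieces of its law *)

Section Quantile.
Context d (Om : measurableType d) (R : realType) (nu : probability Om R).
Variables (X : {RV nu >-> R}) (L : R).
Hypothesis X_itv : forall w, 0 <= X w <= L.

Let F (x : R) : R := fine (cdf X x).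

Let FE x : cdf X x = (F x)%:E.
Proof. by rewrite fineK// fin_num_measure. Qed.

Let F_nd x y : x <= y -> F x <= F y.
Proof. by move=> xy; rewrite -lee_fin -!FE; exact: cdf_nondecreasing. Qed.

Let F_ge0 x : 0 <= F x.
Proof. by rewrite -lee_fin -FE; exact: cdf_ge0. Qed.

Let F_le1 x : F x <= 1.
Proof. by rewrite -lee_fin -FE; exact: cdf_le1. Qed.

Let F_L : F L = 1.
Proof.
apply/EFin_inj; rewrite -FE /cdf /distribution /pushforward.
rewrite (_ : _ @^-1` _ = setT) ?probability_setT//.
by apply/seteqP; split => // w _ /=; rewrite in_itv/=; have /andP[] := X_itv w.
Qed.

Let F_lt0 x : x < 0 -> F x = 0.
Proof.
move=> x0; apply/EFin_inj; rewrite -FE /cdf /distribution /pushforward.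
rewrite (_ : _ @^-1` _ = set0) ?measure0//.
apply/seteqP; split => // w /=; rewrite in_itv/= => Xx.
by have /andP[X0 _] := X_itv w; move: (le_trans X0 Xx); rewrite leNgt x0.
Qed.

(* The bound [0 <= x] makes the set bounded below, hence the infimum meaningful,
   also for [s <= 0]. *)
Definition quantile (s : R) : R := inf [set x | 0 <= x /\ s <= F x].

Let L_ge0 : 0 <= L.
Proof. by have /andP[] := X_itv point; exact: le_trans. Qed.

Let has_inf_quantile s : s <= 1 -> has_inf [set x | 0 <= x /\ s <= F x].
Proof.
by move=> s1; split; [exists L; rewrite /= F_L|exists 0 => x []].
Qed.

Lemma quantile_itv s : s <= 1 -> 0 <= quantile s <= L.
Proof.
move=> s1; have [ne lb] := has_inf_quantile s1; apply/andP; split.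
  by apply: lb_le_inf => // x [].
by apply: ge_inf => //; rewrite /= F_L.
Qed.

Lemma quantile_nd s t : s <= t -> t <= 1 -> quantile s <= quantile t.
Proof.
move=> st t1; have [ne lb] := has_inf_quantile t1.
apply: lb_le_inf => // x [x0 tx]; apply: ge_inf; last first.
  by split => //; exact: le_trans tx.
by have [] := has_inf_quantile (le_trans st t1).
Qed.

(** The Galois connection between quantile and distribution function; right continuity of the latter
    makes the infimum attained. *)
Lemma quantile_le s x : s <= 1 -> 0 <= x -> (quantile s <= x) = (s <= F x).
Proof.
move=> s1 x0; have [ne lb] := has_inf_quantile s1; apply/idP/idP; last first.
  by move=> sx; apply: ge_inf.
move=> qx; apply: (@le_trans _ _ (F (quantile s))); last exact: F_nd.
have Fq : F y @[y --> (quantile s)^'+] --> F (quantile s).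
  by apply: fine_cvg; rewrite -FE; exact: cdf_right_continuous.
apply: (cvgr_to_ge Fq); near=> y.
have : quantile s < y by near: y; exact: nbhs_right_gt.
by move=> /(inf_lt ne)[z [z0 sz] zy]; apply: (le_trans sz); apply: F_nd; exact: ltW.
Unshelve. all: by end_near. Qed.

(** The uniform law lives on the whole line; truncating the sample makes the order of the pieces
    hold for every real [u], not only almost surely. *)
Definition clamp (u : R) : R := Num.min (Num.max u 0) 1.

Lemma clamp_itv u : 0 <= clamp u <= 1.
Proof. by rewrite /clamp le_min le_max lexx orbT ler01 ge_min lexx orbT. Qed.

Lemma clamp_nd u v : u <= v -> clamp u <= clamp v.
Proof. move=> uv; rewrite /clamp !minEle !maxEle.
by do 4 ?[case: ifPn]; rewrite -?ltNge => *; lra. Qed.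

Variable N : nat.
Hypothesis N0 : (0 < N)%N.

Let level (t : nat) (u : R) : R := ((t %% N)%:R + clamp u) / N%:R.

Let N0R : 0 < N%:R :> R. Proof. by rewrite ltr0n. Qed.

Let level_le1 t u : level t u <= 1.
Proof.
rewrite ler_pdivrMr// mul1r.
have : ((t %% N).+1 <= N)%N by rewrite ltn_mod.
by rewrite -(ler_nat R) -natr1; have := clamp_itv u; lra.
Qed.

(* Pieces are indexed by all of [nat], piece [t + N] being piece [t] shifted by one
   turn [L], so that cyclic order can be expressed by [<] on indices. *)
Definition cell_quantile (t : nat) (u : R) : R :=
  quantile (level t u) + L * (t %/ N)%:R.

(** Within one turn a smaller index gives a smaller level; across turns it is enough that all
    quantiles lie in [[0, L]]. *)
Lemma cell_quantile_lt t t' u u' :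
  (t < t')%N -> cell_quantile t u <= cell_quantile t' u'.
Proof.
move=> tt'; rewrite /cell_quantile.
have := leq_div2r N (ltnW tt'); rewrite leq_eqVlt => /predU1P[e|lt].
  rewrite e lerD2r; apply: quantile_nd => //; rewrite /level ler_pM2r ?invr_gt0//.
  have : ((t %% N).+1 <= t' %% N)%N.
    by move: tt'; rewrite (divn_eq t N) (divn_eq t' N) e !modnMDl !modn_mod; lia.
  rewrite -(ler_nat R) -natr1.
  by have := clamp_itv u; have := clamp_itv u'; lra.
have /andP[_ q1] := quantile_itv (level_le1 t u).
have /andP[q2 _] := quantile_itv (level_le1 t' u').
apply: (@le_trans _ _ (L * (t %/ N).+1%:R)); first by rewrite -natr1; lra.
by rewrite -[leLHS]add0r; apply: lerD => //; rewrite ler_wpM2l// ler_nat.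
Qed.

Lemma cell_quantileD t u : cell_quantile (t + N) u = cell_quantile t u + L.
Proof.
rewrite /cell_quantile /level modnDr divnDr ?dvdnn// divnn N0 addn1 -natr1.
by rewrite mulrDr mulr1 addrA.
Qed.

Lemma cell_quantile_nd t u v : u <= v -> cell_quantile t u <= cell_quantile t v.
Proof.
move=> uv; rewrite lerD2r; apply: quantile_nd => //.
by rewrite ler_pM2r ?invr_gt0// lerD2l clamp_nd.
Qed.

Lemma measurable_cell_quantile t :
  measurable_fun setT (cell_quantile t : measurableTypeR R -> measurableTypeR R).
Proof.
by apply: nondecreasing_measurable => // u v; exact: cell_quantile_nd.
Qed.

Let P : probability (measurableTypeR R) R := uniform_prob (@ltr01 R).

Let uniform_probE (U : set R) : measurable U ->
  P U = lebesgue_measure (U `&` `[0, 1]).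
Proof.
move=> mU.
transitivity (\int[lebesgue_measure]_(x in U `&` `[0%R, 1%R])
  (uniform_pdf 0%R 1%R x)%:E)%E.
  exact: integral_uniform_pdf.
rewrite (eq_integral (fun=> 1%:E)); last first.
  move=> x; rewrite inE => -[_ /=]; rewrite in_itv/= /uniform_pdf => ->.
  by rewrite subr0 invr1.
by rewrite integral_cst ?mul1e//; exact: measurableI.
Qed.

Lemma uniform_clamp_gt c : P [set u | c < clamp u] = (1 - clamp c)%:E.
Proof.
have mU : measurable [set u | c < clamp u].
  have mc : measurable_fun setT clamp.
    by apply: nondecreasing_measurable => // u v; exact: clamp_nd.
  rewrite -[X in measurable X]setTI (_ : [set u | _] = clamp @^-1` `]c, +oo[).
    exact: mc.
  by apply/seteqP; split => u /=; rewrite in_itv/= andbT.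
rewrite uniform_probE//; have [c0|c0] := ltP c 0.
  rewrite (_ : _ `&` _ = `[0, 1]%classic).
    rewrite lebesgue_measure_itv/= lte_fin ltr01 /clamp; congr EFin.
    by rewrite minEle maxEle; do 2 ?[case: ifPn]; rewrite -?ltNge => *; lra.
  apply/seteqP; split => [u []//|u u01]; split => //=.
  by have /andP[+ _] := clamp_itv u; exact: lt_le_trans.
have [c1|c1] := leP 1 c.
  rewrite (_ : _ `&` _ = set0).
    rewrite measure0 /clamp; congr EFin.
    by rewrite minEle maxEle; do 2 ?[case: ifPn]; rewrite -?ltNge => *; lra.
  apply/seteqP; split => // u [/= cu _].
  by have /andP[_] := clamp_itv u; lra.
rewrite (_ : _ `&` _ = `]c, 1]%classic).
  rewrite lebesgue_measure_itv/= lte_fin c1 /clamp -EFinB; congr EFin.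
  by rewrite minEle maxEle; do 2 ?[case: ifPn]; rewrite -?ltNge => *; lra.
apply/seteqP; split => u /=; rewrite !in_itv/= /clamp minEle maxEle.
  move=> [+ /andP[]]; do 2 ?[case: ifPn]; rewrite -?ltNge => *;
    by apply/andP; split; lra.
move=> /andP[cu u1]; split; last by apply/andP; split; lra.
by do 2 ?[case: ifPn]; rewrite -?ltNge => *; lra.
Qed.

(** [clamp (y - i)] is the length of [[0, y]] inside [[i, i + 1]]. *)
Lemma sum_clamp n (y : R) : 0 <= y ->
  \sum_(i < n) clamp (y - i%:R) = Num.min y n%:R.
Proof.
move=> y0; elim: n => [|n IH]; first by rewrite big_ord0; case: ltP => //; lra.
rewrite big_ord_recr/= IH /clamp -natr1 !minEle !maxEle.
by do 4 ?[case: ifPn]; rewrite -?ltNge => *; lra.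
Qed.

(** Both sides are finite measures in [A], so it suffices to compare them on the half lines []x,
    +oo[], which generate the Borel sets and are closed under intersection. *)
Lemma cell_quantile_mixture (A : set (measurableTypeR R)) : measurable A ->
  (N%:R%:E * nu (X @^-1` A) = \sum_(t < N) P (cell_quantile t @^-1` A))%E.
Proof.
pose Q t := image_measure P (measurable_cell_quantile t).
have mX : measurable_fun setT (X : Om -> measurableTypeR R).
  by have : measurable_fun setT X.
pose m1 : {measure set (measurableTypeR R) -> \bar R} :=
  mscale (NngNum (ler0n R N)) (image_measure nu mX).
move=> mA; suff : m1 A = msum Q N A by [].
apply: (@measure_unique _ R (measurableTypeR R) (@RGenOInfty.G R)
  (fun k => `](- k%:R : R), +oo[%classic) _ _ _ _ m1 (msum Q N)) => //.
- exact: RGenOInfty.measurableE.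
- move=> _ _ [x ->] [y ->]; exists (Num.max x y).
  by apply/seteqP; split => z /=; rewrite !in_itv/= !andbT gt_max => /andP.
- by move=> k; exists (- k%:R).
- apply/seteqP; split => // x _; exists (Num.truncn (`|x| + 1)).+1 => //=.
  rewrite in_itv/= andbT ltrNl.
  have := real_truncnS_gt (num_real (`|x| + 1)).
  have := ler_norm (- x); rewrite normrN.
  by lra.
- move=> _ [x ->].
  have -> : m1 `]x, +oo[%classic = (N%:R * (1 - F x))%:E.
    rewrite EFinM; congr (_ * _)%E; rewrite -setCitvl.
    rewrite -[LHS]/(distribution nu X (~` `]-oo, x])) probability_setC//.
    by rewrite EFinB; congr (1 - _)%E; exact: FE.
  (* [clamp (N F(x) - t)] is the probability that piece [t] falls at or below [x]; these add up to
     [N F(x)] because [F(x) <= 1]. *)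
  transitivity (\sum_(t < N) (1 - clamp (N%:R * F x - t%:R))%:E)%E.
    rewrite sumEFin sumrB sumr_const card_ord sum_clamp ?mulr_ge0//.
    by rewrite min_l ?ler_piMr// mulrBr mulr1.
  apply: eq_bigr => t _.
  have mod_t : (t %% N = t)%N by rewrite modn_small.
  have div_t : (t %/ N = 0)%N by rewrite divn_small.
  rewrite -[RHS]/(P (cell_quantile t @^-1` `]x, +oo[)).
  (* For negative [x], where [quantile_le] does not apply, every quantile exceeds [x] and
     [F(x) = 0]. *)
  have [x0|x0] := ltP x 0.
    rewrite (_ : _ @^-1` _ = setT).
      rewrite [RHS]probability_setT F_lt0// mulr0 sub0r /clamp max_r ?oppr_le0//.
      by rewrite min_l// subr0.
    apply/seteqP; split => // u _ /=; rewrite in_itv/= andbT.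
    rewrite /cell_quantile div_t mulr0 addr0; apply: (lt_le_trans x0).
    by have /andP[] := quantile_itv (level_le1 t u).
  rewrite -uniform_clamp_gt; congr (P _).
  apply/seteqP; split => u /=;
    rewrite in_itv/= andbT /cell_quantile div_t mulr0 addr0 !ltNge quantile_le//;
    by rewrite /level mod_t ler_pdivrMr// mulrC lerBrDl addrC.
- move=> k; apply: (@le_lt_trans _ _ (m1 setT)); first by rewrite le_measure ?inE.
  rewrite -[X in (X < _)%E]/(N%:R%:E * nu setT)%E.
  by rewrite (_ : nu setT = 1%E) ?mule1 ?ltry//; exact: probability_setT.
Qed.
End Quantile.

(** * The bound *)

Section SymmetricBound.
Variables (R : realType) (nu : probability (circle R) R).
Variable S : set (triangle_space R).
Hypothesis mS : measurable S.
Hypothesis S_int : intersecting_family S.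
Hypothesis S_swap12 : forall p q r, S (p, q, r) -> S (q, p, r).
Hypothesis S_swap23 : forall p q r, S (p, q, r) -> S (p, r, q).

Let mangle : measurable_fun [set: circle R] (@angle R : circle R -> R).
Proof. exact: measurable_angle. Qed.

Let angle_mixin := isMeasurableFun.Build _ _ _ _ _ mangle.
Let X : {RV nu >-> R} := HB.pack (@angle R) angle_mixin.
Let P : probability (measurableTypeR R) R := uniform_prob (@ltr01 R).

Variable m : nat.
Let N := m.*2.+1.
Let theta : nat -> R -> R := cell_quantile X (pi *+ 2) N.
Let g (t : nat) (u : measurableTypeR R) : circle R := arg_point (theta t u).

Let X_itv w : 0 <= X w <= pi *+ 2. Proof. exact: angle_itv. Qed.

Let mg t : measurable_fun setT (g t).
Proof.
apply: measurableT_comp; first exact: measurable_arg_point.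
exact: measurable_cell_quantile.
Qed.

Let gD t : g (t + N) = g t.
Proof. by apply/funext => u; rewrite /g /theta cell_quantileD// arg_pointD2pi. Qed.

(** By [angleK], [nu] is the image under [arg_point] of the law of the angle, whose decomposition it
    inherits. *)
Let nuE (A : set (circle R)) : measurable A ->
  (N%:R%:E * nu A = \sum_(i < N) P (g i @^-1` A))%E.
Proof.
move=> mA; rewrite -(cell_quantile_mixture X_itv (ltn0Sn _)
  (A := (@arg_point R : measurableTypeR R -> circle R) @^-1` A)).
  congr (_ * nu _)%E; apply/seteqP; split => p /=; rewrite angleK//.
by rewrite -[X in measurable X]setTI; exact: measurable_arg_point.
Qed.

(** The probability that a triangle with independent vertices drawn from the pieces [i], [j], [k]
    belongs to [S]. *)
Let J i j k := integral3 P (cell_indic R g S i j k).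

Let mJ i j k : jointly_measurable (cell_indic R g S i j k).
Proof. exact: measurable_cell_indic. Qed.

Let cell_ge0 i j k u v w : (0 <= cell_indic R g S i j k u v w)%E.
Proof. by rewrite lee_fin. Qed.

Let J01 i j k : (0 <= J i j k <= 1)%E.
Proof.
apply: integral3_le1 => // u v w.
by rewrite /cell_indic indicE !lee_fin ler0n lern1 leq_b1.
Qed.

Let in_swap12 p q r : ((q, p, r) \in S) = ((p, q, r) \in S).
Proof. by apply/idP/idP; rewrite !inE => /S_swap12. Qed.

Let in_swap23 p q r : ((p, r, q) \in S) = ((p, q, r) \in S).
Proof. by apply/idP/idP; rewrite !inE => /S_swap23. Qed.

Let J_swap12 i j k : J j i k = J i j k.
Proof.
have e : cell_indic R g S j i k = fun u v w => cell_indic R g S i j k v u w.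
  by do 3 (apply/funext => ?); rewrite /cell_indic !indicE in_swap12.
rewrite /J e; exact: (integral3_swap12 P (@mJ i j k) (@cell_ge0 i j k)).
Qed.

Let J_swap23 i j k : J i k j = J i j k.
Proof.
have e : cell_indic R g S i k j = fun u v w => cell_indic R g S i j k u w v.
  by do 3 (apply/funext => ?); rewrite /cell_indic !indicE in_swap23.
rewrite /J e; exact: (integral3_swap23 P (@mJ i j k) (@cell_ge0 i j k)).
Qed.

(** Samples from pieces of different index are always ordered, so [family_clique] holds pointwise
    and can be integrated. Two samples from one piece may come in either order, hence the factors
    that drop [x = 0], [y = 0], [z = 0]. *)
Let J_clique i a b x y z :
  (a + b < N)%N -> (x < a)%N -> (y < b)%N -> (z < N - a - b)%N ->
  (J i (i + a)%N (i + a + b)%N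
  + (0 < x)%N%:R%:E * J i (i + a)%N (i + x)%N
  + (0 < y)%N%:R%:E * J (i + a)%N (i + a + b)%N (i + a + y)%N
  + (0 < z)%N%:R%:E * J i (i + a + b)%N (i + a + b + z)%N <= 1)%E.
Proof.
move=> ab xa yb zc.
pose h (c : bool) i j k (u v w : measurableTypeR R) : \bar R :=
  (c%:R%:E * cell_indic R g S i j k u v w)%E.
have mh c i' j k : jointly_measurable (h c i' j k).
  by apply: measurable_funeM; exact: mJ.
have h0 c i' j k u v w : (0 <= h c i' j k u v w)%E.
  by rewrite /h mule_ge0// lee_fin.
have hJ (c : bool) i' j k : (c%:R%:E * J i' j k)%E = integral3 P (h c i' j k).
  case: c; rewrite ?mul1e ?mul0e.
    have -> : h true i' j k = cell_indic R g S i' j k.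
      by do 3 (apply/funext => ?); rewrite /h mul1e.
    exact: erefl.
  have -> : h false i' j k = fun _ _ _ => 0%E.
    by do 3 (apply/funext => ?); rewrite /h mul0e.
  by rewrite /integral3 !integral_cst_prob.
rewrite -[J i _ _]mul1e -[X in (X * _ + _ + _ + _)%E]/(true%:R%:E) !hJ.
apply: integral3_clique => // p q r w.
have cell_le t t' u u' : (t < t')%N -> theta t u <= theta t' u'.
  exact: cell_quantile_lt.
have thetaD t u : theta (t + N) u = theta t u + pi *+ 2 by exact: cell_quantileD.
have hE (c : bool) t1 t2 t3 u1 u2 u3 : h c t1 t2 t3 u1 u2 u3 =
    (c && ((g t1 u1, g t2 u2, g t3 u3) \in S))%:R%:E.
  by rewrite /h /cell_indic indicE -EFinM -natrM mulnb.
rewrite !hE -!EFinD lee_fin -!natrD lern1 andTb.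
apply: (family_clique S_int S_swap12 S_swap23).
- by apply: cell_le; lia.
- by apply: cell_le; lia.
- by rewrite -thetaD; apply: cell_le; lia.
- by move=> x0; apply/andP; split; apply: cell_le; lia.
- by move=> y0; apply/andP; split; apply: cell_le; lia.
- by move=> z0; rewrite -thetaD; apply/andP; split; apply: cell_le; lia.
Qed.

Lemma symmetric_family_le :
  (((nu \x nu) \x nu) S <= (4^-1 + 3 / N%:R : R)%:E)%E.
Proof.
pose M i j k := fine (J i j k).
have JE i j k : J i j k = (M i j k)%:E.
  have /andP[J0 J1] := J01 i j k.
  by rewrite fineK// ge0_fin_numE// (le_lt_trans J1)// ltry.
have M01 i j k : 0 <= M i j k <= 1 by rewrite -!lee_fin -JE.
have M12 i j k : M j i k = M i j k by rewrite /M J_swap12.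
have M23 i j k : M i k j = M i j k by rewrite /M J_swap23.
have MD i j k : M i j (k + N)%N = M i j k by rewrite /M /J /cell_indic gD.
have Mc i a b x y z (ab : (a + b < N)%N) (xa : (x < a)%N) (yb : (y < b)%N)
    (zc : (z < N - a - b)%N) : M i (i + a)%N (i + a + b)%N
    + (0 < x)%N%:R * M i (i + a)%N (i + x)%N
    + (0 < y)%N%:R * M (i + a)%N (i + a + b)%N (i + a + y)%N
    + (0 < z)%N%:R * M i (i + a + b)%N (i + a + b + z)%N <= 1.
  by have := J_clique i ab xa yb zc; rewrite !JE.
have sumE : (\sum_(i < N) \sum_(j < N) \sum_(k < N) J i j k)%E =
    (\sum_(0 <= i < N) \sum_(0 <= j < N) \sum_(0 <= k < N) M i j k)%:E.
  rewrite big_mkord -sumEFin; apply: eq_bigr => i _.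
  rewrite big_mkord -sumEFin; apply: eq_bigr => j _.
  by rewrite big_mkord -sumEFin; apply: eq_bigr => k _; exact: JE.
have := product3_mixture mg nuE mS; rewrite sumE.
have -> : (((nu \x nu) \x nu) S)%E = (fine (((nu \x nu) \x nu) S)%E)%:E.
  rewrite fineK//.
  exact: (fin_num_measure (((nu \x nu) \x nu)%E : probability _ R)).
move: (fine _) => mu; rewrite -!EFinM => -[muE]; rewrite lee_fin.
have := sum_triples_le M01 M12 M23 MD Mc; rewrite -muE.
have NE : N%:R = 2 * m%:R + 1 :> R by rewrite /N -natr1 -mul2n natrM.
have mE : (m * m.+1)%:R = m%:R * (m%:R + 1) :> R by rewrite natrM -natr1.
rewrite mE -/N NE; have := ler0n R m; move: (m%:R) => x x0 h.
have N0 : 0 < 2 * x + 1 by lra.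
have -> : 4^-1 + 3 / (2 * x + 1) =
    ((2 * x + 1) ^+ 3 / 4 + 3 * (2 * x + 1) ^+ 2) / (2 * x + 1) ^+ 3.
  by field; rewrite gt_eqF.
rewrite ler_pdivlMr ?exprn_gt0//.
apply: le_trans (_ : (2 * x + 1) * (x * (x + 1)) + 3 * (2 * x + 1) ^+ 2 <= _).
  by apply: le_trans h; rewrite le_eqVlt; apply/orP; left; apply/eqP; ring.
(* Here [x] stands for [m], and [x (x + 1) <= (2 x + 1)^2 / 4]. *)
by rewrite lerD2r; nra.
Qed.
End SymmetricBound.

(** * Reduction to symmetric families *)

Section Symmetrization.
Variables (R : realType) (F : set (triangle_space R)).

(** The union of [F] over the six orders of the vertices. It contains [F], and it inherits the
    intersecting property because a triangle does not depend on the order of its vertices. *)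
Definition symmetrization : set (triangle_space R) :=
  F `|` [set t | F (t.1.1, t.2, t.1.2)] `|` [set t | F (t.1.2, t.1.1, t.2)]
  `|` [set t | F (t.1.2, t.2, t.1.1)] `|` [set t | F (t.2, t.1.1, t.1.2)]
  `|` [set t | F (t.2, t.1.2, t.1.1)].

Lemma triangle_swap12 (p q r : circle R) : triangle (q, p, r) = triangle (p, q, r).
Proof.
by apply/seteqP; split => z [a [b [c [a0 b0 c0 abc ->]]]]; exists b, a, c; split;
  rewrite // ?[b + a]addrC ?[b *: _ + _]addrC.
Qed.

Lemma triangle_swap23 (p q r : circle R) : triangle (p, r, q) = triangle (p, q, r).
Proof.
by apply/seteqP; split => z [a [b [c [a0 b0 c0 abc ->]]]]; exists a, c, b; split;
  rewrite // addrAC.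
Qed.

Lemma symmetrization_triangle t : symmetrization t ->
  exists2 s, F s & triangle s = triangle t.
Proof.
case: t => -[p q] r [[[[[]|]|]|]|] /= Fs; eexists; try exact: Fs.
- by [].
- exact: triangle_swap23.
- exact: triangle_swap12.
- by rewrite triangle_swap23 triangle_swap12.
- by rewrite triangle_swap12 triangle_swap23.
- by rewrite triangle_swap12 triangle_swap23 triangle_swap12.
Qed.

Lemma symmetrization_intersecting :
  intersecting_family F -> intersecting_family symmetrization.
Proof.
move=> hF s t /symmetrization_triangle[s' Fs' es].
move=> /symmetrization_triangle[t' Ft' et].
by rewrite /triangles_intersect -es -et; exact: hF.
Qed.

Lemma symmetrization_swap12 p q r :
  symmetrization (p, q, r) -> symmetrization (q, p, r).
Proof. by rewrite /symmetrization /setU /=; tauto. Qed.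

Lemma symmetrization_swap23 p q r :
  symmetrization (p, q, r) -> symmetrization (p, r, q).
Proof. by rewrite /symmetrization /setU /=; tauto. Qed.

Lemma measurable_symmetrization : measurable F -> measurable symmetrization.
Proof.
move=> mF.
have m11 : measurable_fun setT (fun t : triangle_space R => t.1.1).
  exact: measurableT_comp.
have m12 : measurable_fun setT (fun t : triangle_space R => t.1.2).
  exact: measurableT_comp.
have m2 : measurable_fun setT (fun t : triangle_space R => t.2).
  exact: measurable_snd.
have mperm (f g h : triangle_space R -> circle R) : measurable_fun setT f ->
    measurable_fun setT g -> measurable_fun setT h ->
    measurable [set t | F (f t, g t, h t)].
  move=> mf mg mh; rewrite -[X in measurable X]setTI.
  have mfgh := measurable_fun_pair (measurable_fun_pair mf mg) mh.
  exact: (mfgh measurableT _ mF).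
by do 5 ?[apply: measurableU]; do ?[exact: mF]; apply: mperm.
Qed.
End Symmetrization.

Unset Implicit Arguments.

Theorem theorem3 (R : realType) (nu : probability (circle R) R)
    (F : set (triangle_space R)) (mF : measurable F)
    (hF : intersecting_family F) :
  (((nu \x nu) \x nu) F <= (1 / 4 : R)%:E)%E.
Proof.
pose mu : probability _ R := ((nu \x nu) \x nu)%E.
have mS := measurable_symmetrization mF.
apply: (@le_trans _ _ (mu (symmetrization F))).
  by apply: (le_measure mu); rewrite ?inE// => t Ft; do 5 left.
have bound m : (mu (symmetrization F) <= (4^-1 + 3 / m.*2.+1%:R : R)%:E)%E.
  apply: symmetric_family_le => //.
  - exact: symmetrization_intersecting.
  - exact: symmetrization_swap12.
  - exact: symmetrization_swap23.
move: bound; rewrite -[mu _]fineK; last exact: fin_num_measure.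
move: (fine _) => x bound; rewrite lee_fin div1r leNgt; apply/negP => x4.
(* An excess [e] over 1/4 contradicts the bound [1/4 + 3 / N] as soon as [N > 3 / e]. *)
pose e := x - 4^-1; have e0 : 0 < e by rewrite subr_gt0.
have := bound (Num.truncn (3 / e)); rewrite lee_fin.
set n := _.*2.+1; have n3 : 3 / e < n%:R.
  apply: lt_le_trans (real_truncnS_gt (num_real (3 / e))) _.
  by rewrite ler_nat /n; lia.
rewrite -lerBlDl -/e ler_pdivlMr ?ltr0n// => en.
by move: n3; rewrite ltr_pdivrMr// mulrC ltNge en.
Qed.
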